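(* Let $n$ be the number of qubits of the oracle, $N=2^n$, and let $k<n$. Consider the oracle decision problem $\Omega_{\mathrm{reflect}(k,n)}=(\Omega_{\mathrm{Yes}},\Omega_{\mathrm{No}})$ where $\Omega_{\mathrm{Yes}}=\{\mathcal O_S=\mathbb I-2\Pi_S : S\subseteq\mathbb C^N \text{ a nonzero subspace with } \dim S\le 2^k\}$ ($\Pi_S$ the orthogonal projector onto $S$) and $\Omega_{\mathrm{No}}=\{\mathbb I\}$. Suppose an $L$-query oracle verifier uniquely decides $\Omega_{\mathrm{reflect}(k,n)}$ with error $\varepsilon\in O(\exp(-n))$ (in particular it must work for every subspace $S$ of every dimension $1\le \dim S\le 2^k$). Then $L=\Omega(\sqrt{2^k})$. In particular, if $k=\Omega(n)$, the number of queries is exponential in $n$.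
   Context: An $L$-query oracle verifier acts on a witness register $R_{\mathrm{in}}$ and an auxiliary register $R_{\mathrm{aux}}$ initialized to $|0\cdots0\rangle$; $R_{\mathrm{aux}}$ contains an $n$-qubit oracle register $R_{\mathcal O}$ and a designated output qubit $R_{\mathrm{out}}$. Given an $n$-qubit unitary $\mathcal O$, on witness $|\omega\rangle$ the verifier applies $U_0$, then alternately a controlled query $\mathcal O^{\Pi}=(\mathbb I-\Pi)\otimes\mathbb I+\Pi\otimes\mathcal O$ (with $\mathcal O$ acting on $R_{\mathcal O}$ and $\Pi$ a projector on the remaining registers) and fixed unitaries $U_1,\dots,U_L$ (the $U_j$ and control projectors do not depend on $\mathcal O$), i.e. the state $U_L\mathcal O^{\Pi}U_{L-1}\cdots U_1\mathcal O^{\Pi}U_0(|\omega\rangle|0\cdots0\rangle)$, and finally measures $R_{\mathrm{out}}$ in the computational basis, accepting on outcome $1$; let $p_{\mathcal O}(\omega)$ be the acceptance probability. An oracle decision problem is a pair $(\Omega_{\mathrm{Yes}},\Omega_{\mathrm{No}})$ of disjoint sets of unitaries. The verifier uniquely decides it with error $\varepsilon$ if (i) for every $\mathcal O\in\Omega_{\mathrm{Yes}}$ there is a witness $|\omega\rangle$ with $p_{\mathcal O}(\omega)\ge1-\varepsilon$ and $p_{\mathcal O}(\omega')\le\varepsilon$ for every $|\omega'\rangle\perp|\omega\rangle$; (ii) for $\mathcal O\in\Omega_{\mathrm{No}}$, $p_{\mathcal O}(\omega)\le\varepsilon$ for all witnesses $|\omega\rangle$. The witness register may be of arbitrary size. 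*)

(* Defs.v *)
From HB Require Import structures.
From mathcomp Require Import all_boot all_order all_algebra.
From mathcomp Require Import complex mxtens.
From mathcomp Require Import reals sequences exp.

Set Implicit Arguments.
Unset Strict Implicit.
Unset Printing Implicit Defensive.

Import Order.TTheory GRing.Theory Num.Theory.
Local Open Scope ring_scope.

Section QuantumVerifier.
Variable R : realType.
Local Notation C := R[i].

Definition adjmx {p q : nat} (A : 'M[C]_(p, q)) : 'M[C]_(q, p) :=
  (map_mx Num.conj A)^T.

Definition unitarymx {d : nat} (U : 'M[C]_d) : Prop :=
  adjmx U *m U = 1%:M /\ U *m adjmx U = 1%:M.

Definition orth_projector {d : nat} (P : 'M[C]_d) : Prop :=
  P *m P = P /\ adjmx P = P.

Definition sqnorm {d : nat} (v : 'cV[C]_d) : R :=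
  \sum_(i < d) ((complex.Re (v i 0)) ^+ 2 + (complex.Im (v i 0)) ^+ 2).
Definition inner {d : nat} (u v : 'cV[C]_d) : C :=
  \sum_(i < d) Num.conj (u i 0) * v i 0.

Lemma pow2_gt0 (a : nat) : (0 < 2 ^ a)%N.
Proof. by rewrite expn_gt0. Qed.
Definition ket0 (a : nat) : 'cV[C]_(2 ^ a) :=
  delta_mx (Ordinal (pow2_gt0 a)) 0.

(** Register layout: the total Hilbert space is
      ((R_in (w qubits) (x) R_out (1 qubit)) (x) R_rest (a qubits)) (x) R_O (n qubits)
    i.e. the registers other than the oracle register form the first factor
    (of dimension K w a = (2^w * 2) * 2^a) and the oracle register R_O the
    second factor (dimension 2^n).  R_aux = R_O (x) R_out (x) R_rest. *)
Definition Kdim (w a : nat) := ((2 ^ w * 2) * 2 ^ a)%N.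
Definition Ddim (w a n : nat) := (Kdim w a * 2 ^ n)%N.

Record verifier (n w a : nat) := Verifier {
  vU : nat -> 'M[C]_(Ddim w a n);   (* U_0, ..., U_L *)
  vPi : nat -> 'M[C]_(Kdim w a)     (* control projector of query j (j = 1..L) *)
}.

Definition valid_verifier n w a (L : nat) (V : verifier n w a) : Prop :=
  (forall j, (j <= L)%N -> unitarymx (vU V j)) /\
  (forall j, (1 <= j <= L)%N -> orth_projector (vPi V j)).

Definition ctrl_query w a n (Pi : 'M[C]_(Kdim w a)) (O : 'M[C]_(2 ^ n))
  : 'M[C]_(Ddim w a n) :=
  (1%:M - Pi) *t (1%:M : 'M[C]_(2 ^ n)) + Pi *t O.

Definition init_state w a n (omega : 'cV[C]_(2 ^ w)) : 'cV[C]_(Ddim w a n) :=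
  ((omega *t (delta_mx 0 0 : 'cV[C]_2)) *t ket0 a) *t ket0 n.

Fixpoint run_state w a n (V : verifier n w a) (O : 'M[C]_(2 ^ n))
    (psi0 : 'cV[C]_(Ddim w a n)) (j : nat) : 'cV[C]_(Ddim w a n) :=
  match j with
  | 0 => vU V 0 *m psi0
  | j'.+1 => vU V j'.+1 *m (ctrl_query (vPi V j'.+1) O *m run_state V O psi0 j')
  end.

Definition out1_proj w a n : 'M[C]_(Ddim w a n) :=
  (((1%:M : 'M[C]_(2 ^ w)) *t (delta_mx 1 1 : 'M[C]_2))
     *t (1%:M : 'M[C]_(2 ^ a))) *t (1%:M : 'M[C]_(2 ^ n)).

Definition accept_prob n w a (L : nat) (V : verifier n w a)
    (O : 'M[C]_(2 ^ n)) (omega : 'cV[C]_(2 ^ w)) : R :=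
  sqnorm (out1_proj w a n *m run_state V O (init_state a n omega) L).

(** Omega_reflect(k,n): Yes instances  O_S = I - 2 Pi_S, S a nonzero subspace
    of C^(2^n) of dimension <= 2^k (Pi_S is an orthogonal projector whose
    rank is dim S); the only No instance is I. *)
Definition reflect_yes (k n : nat) (O : 'M[C]_(2 ^ n)) : Prop :=
  exists P : 'M[C]_(2 ^ n),
    orth_projector P /\ (0 < \rank P <= 2 ^ k)%N /\ O = 1%:M - 2%:R *: P.

Definition reflect_no (n : nat) (O : 'M[C]_(2 ^ n)) : Prop := O = 1%:M.

Definition uniquely_decides n w a (L : nat) (V : verifier n w a)
    (Yes No : 'M[C]_(2 ^ n) -> Prop) (eps : R) : Prop :=
  (forall O, Yes O ->
     exists omega : 'cV[C]_(2 ^ w),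
       sqnorm omega = 1 /\ 1 - eps <= accept_prob L V O omega /\
       (forall omega' : 'cV[C]_(2 ^ w), sqnorm omega' = 1 ->
          inner omega omega' = 0 -> accept_prob L V O omega' <= eps)) /\
  (forall O, No O ->
     forall omega : 'cV[C]_(2 ^ w), sqnorm omega = 1 ->
       accept_prob L V O omega <= eps).

End QuantumVerifier.

(* Main.v *)
(** Let D = 2^k and, for X a subset of D fixed basis vectors, let T_X be the
    operator mapping a witness to its accepting component when the oracle is
    the reflection about the span of X.  Let Q be the orthogonal projector onto
    the span of the D witnesses attached to the singletons, and put
    f(X) = ||T_X Q||^2 in Frobenius norm.  Then f is a multilinear polynomial of
    degree at most 2L in the indicator bits of X; f(set0) <= eps D, since the
    identity is rejected; f({i}) >= 1 - eps; and f(X) <= 2 + 2 eps D for all X,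
    because T_X has one large direction and Q has rank at most D, whatever the
    size of the witness register.  As eps D tends to 0, the expectation of f
    over a random X containing each element with probability t is a polynomial
    in t of degree 2L, bounded on [0, 1], with slope about D at 0, so Markov's
    inequality for derivatives of polynomials forces D = O(L^2). *)

Require Import Defs.
From HB Require Import structures.
From mathcomp Require Import all_boot all_order all_algebra.
From mathcomp Require Import complex mxtens.
From mathcomp Require Import reals sequences exp.
From mathcomp Require Import ring lra zify.
Import Order.TTheory GRing.Theory Num.Theory.
Local Open Scope ring_scope.

(** * Finite differences and Markov's inequality at an endpoint of an interval *)

(** Induction on the order: write [p] as [p.[a]] plus [q] times ['X - a%:P]. The constant
    contributes a multiple of [(1 - 1) ^+ n.+1]. In the rest, absorbing the factor [i] into the
    binomial coefficient leaves a multiple of the difference of order [n] of [q] at [a + 1]. *)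
Lemma alternating_binomial_horner_eq0 (F : comNzRingType) (n : nat)
    (p : {poly F}) (a : F) : (size p <= n)%N ->
  \sum_(i < n.+1) ((-1) ^+ i * p.[a + i%:R]) *+ 'C(n, i) = 0.
Proof.
elim: n p a => [|n IHn] p a.
  by rewrite leqn0 size_poly_eq0 => /eqP->; rewrite big_ord1 horner0 mulr0.
move=> sz_p.
have [q def_q] : exists q, p - (p.[a])%:P = q * ('X - a%:P).
  by apply/factor_theorem; rewrite rootE !hornerE subrr.
have sz_q : (size q <= n)%N.
  have [->|q0] := eqVneq q 0; first by rewrite size_poly0.
  have := size_Mmonic q0 (monicXsubC a); rewrite -def_q size_XsubC addn2 /= => szE.
  rewrite -ltnS -szE; apply: (leq_trans (size_polyD _ _)); rewrite size_polyN.
  by rewrite geq_max sz_p (leq_trans (size_polyC_leq1 _)).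
have pE (i : nat) : p.[a + i%:R] = p.[a] + i%:R * q.[a + i%:R].
  have := congr1 (fun r => r.[a + i%:R]) def_q; rewrite !hornerE => /eqP.
  by rewrite subr_eq => /eqP ->; ring.
under eq_bigr do rewrite pE mulrDr mulrnDl.
rewrite big_split /=.
have -> : \sum_(i < n.+2) ((-1) ^+ i * p.[a]) *+ 'C(n.+1, i) = 0.
  transitivity (p.[a] * (1 - 1) ^+ n.+1); last by rewrite subrr expr0n mulr0.
  rewrite exprBn mulr_sumr; apply: eq_bigr => i _.
  by rewrite !expr1n !mulr1 -mulrnAl mulrC.
rewrite add0r big_ord_recl /= mul0r mulr0 mul0rn add0r.
transitivity (- n.+1%:R *
    \sum_(i < n.+1) ((-1) ^+ i * q.[a + 1 + i%:R]) *+ 'C(n, i)); last first.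
  by rewrite IHn // mulr0.
rewrite mulr_sumr; apply: eq_bigr => i _.
rewrite /bump /= !add1n.
have binE : ('C(n.+1, i.+1) * i.+1 = n.+1 * 'C(n, i))%N by rewrite mulnC -mul_bin_diag.
rewrite -[LHS]mulr_natl -[in RHS]mulr_natl.
have -> : a + 1 + i%:R = a + i.+1%:R by rewrite -natr1; ring.
rewrite exprS.
transitivity (- ('C(n.+1, i.+1) * i.+1)%:R * (-1) ^+ i * q.[a + i.+1%:R]).
  by rewrite natrM; ring.
by rewrite binE natrM; ring.
Qed.

(** Beyond the centre, the ratio of consecutive binomial coefficients is at most 1; symmetry handles
    the other half. *)
Lemma leq_bin_central (m i : nat) : ('C(m.*2, i) <= 'C(m.*2, m))%N.
Proof.
have up (j : nat) : ('C(m.*2, m + j) <= 'C(m.*2, m))%N.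
  elim: j => [|j IHj]; first by rewrite addn0.
  apply: leq_trans IHj; rewrite addnS.
  have := mul_bin_left m.*2 (m + j) => E.
  rewrite -(leq_pmul2l (ltn0Sn (m + j))) E leq_mul2r.
  by apply/orP; right; lia.
have [le_mi|lt_im] := leqP m i; first by rewrite -(subnKC le_mi).
rewrite -bin_sub; last by lia.
by rewrite (_ : (m.*2 - i)%N = (m + (m - i))%N) //; lia.
Qed.

Lemma sum_inv_sq_le2 (F : realFieldType) (m : nat) :
  \sum_(j < m) ((j.+1%:R : F) ^+ 2)^-1 <= 2.
Proof.
case: m => [|m]; first by rewrite big_ord0; lra.
(* The term subtracted from 2 makes the induction go through: with [a = m.+1], the bound at the next
   step has slack exactly [1 / (a * (a + 1) ^+ 2)]. *)
suff le_m : \sum_(j < m.+1) ((j.+1%:R : F) ^+ 2)^-1 <= 2 - (m.+1%:R)^-1.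
  by apply: (le_trans le_m); rewrite gerBl invr_ge0 ler0n.
elim: m => [|m IHm]; first by rewrite big_ord1 expr1n invr1; lra.
rewrite big_ord_recr /=; apply: (le_trans (lerD IHm (lexx _))).
have a0 : (0 : F) < m.+1%:R by rewrite ltr0n.
rewrite -[m.+2%:R]natr1; set a := m.+1%:R in a0 *.
rewrite -subr_ge0 (_ : _ - _ = (a * (a + 1) ^+ 2)^-1).
  by rewrite invr_ge0 mulr_ge0 ?sqr_ge0 // ltW.
by field; rewrite !gt_eqF //; lra.
Qed.

(* Markov's inequality at an endpoint, up to the constant.  Sampling [q] at
   the points [(j / m) ^+ 2], for [j] from [- m] to [m], turns
   [(q - q.[0]) / 'X] into a polynomial in [j] of degree below [2 m], which is
   annihilated by the [2 m]-th finite difference; the central term of the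
   latter is [q`_1], and it has the largest binomial weight. *)
Lemma coef1_le_of_bounded (F : realFieldType) (m : nat) (q : {poly F}) (B : F) :
  (size q <= m.+1)%N ->
  (forall t : F, 0 <= t <= 1 -> 0 <= q.[t] <= B) ->
  q`_1 <= 4 * m%:R ^+ 2 * B.
Proof.
move=> sz_q q_bnd.
case: m => [|m] in sz_q *; first by rewrite nth_default // expr0n mulr0 mul0r.
set M : F := m.+1%:R.
have M0 : 0 < M by rewrite ltr0n.
have [p def_p] : exists p, q - (q.[0])%:P = p * 'X.
  have /factor_theorem[p] : root (q - (q.[0])%:P) 0.
    by rewrite rootE !hornerE subrr.
  by rewrite subr0; exists p.
have sz_p : (size p <= m.+1)%N.
  have [->|p0] := eqVneq p 0; first by rewrite size_poly0.
  have := size_Mmonic p0 (monicX _); rewrite -def_p size_polyX addn2 /= => szE.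
  rewrite -ltnS -szE; apply: (leq_trans (size_polyD _ _)); rewrite size_polyN.
  by rewrite geq_max sz_q (leq_trans (size_polyC_leq1 _)).
have p0E : p.[0] = q`_1.
  have := congr1 (fun r : {poly F} => r`_1) def_p.
  by rewrite coefB coefC coefMX /= subr0 => ->; rewrite horner_coef0.
(* [q.[t]] and [q.[0]] both lie in [[0, B]], so they differ by at most [B]. *)
have p_bnd t : 0 < t <= 1 -> `|p.[t]| <= B / t.
  move=> /andP[t0 t1]; have := congr1 (fun r => r.[t]) def_p; rewrite !hornerE => ptE.
  have /andP[q00 q0B] := q_bnd 0 ltac:(by rewrite lexx ler01).
  have /andP[qt0 qtB] := q_bnd t ltac:(by rewrite ltW).
  rewrite ler_pdivlMr // -[X in _ * X](gtr0_norm t0) -normrM -ptE ler_norml.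
  by apply/andP; split; lra.
pose h := p \Po (M^-1 ^+ 2 *: 'X^2).
have hE x : h.[x] = p.[(x / M) ^+ 2] by rewrite horner_comp hornerZ hornerXn exprMn mulrC.
have sz_h : (size h <= m.+1.*2)%N.
  apply: (leq_trans (size_comp_poly_leq _ _)).
  have pred_le (x y : nat) : (x <= y.+1 -> x.-1 <= y)%N by lia.
  apply: (@leq_trans (m * 2).+1); last by lia.
  rewrite ltnS; apply: leq_mul; apply: pred_le => //.
  by apply: (leq_trans (size_scale_leq _ _)); rewrite size_polyXn.
have B0 : 0 <= B by have /andP[/le_trans le1 /le1] := q_bnd 0 ltac:(by rewrite lexx ler01).
have h_bnd (j : nat) : (0 < j <= m.+1)%N -> `|h.[j%:R]| <= B * M ^+ 2 * (j%:R ^+ 2)^-1.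
  move=> /andP[j0 jm]; have j0' : (0 : F) < j%:R by rewrite ltr0n.
  rewrite hE; apply: (le_trans (p_bnd _ _)).
    rewrite exprn_gt0 ?divr_gt0 //= expr_le1 ?divr_ge0 ?ler0n //.
    by rewrite ler_pdivrMr // mul1r ler_nat.
  by rewrite expr_div_n invf_div mulrA.
have hN x : h.[- x] = h.[x] by rewrite !hE mulNr sqrrN.
pose N := m.+1; pose c : F := 'C(N.*2, N)%:R.
pose G (i : nat) := ((-1) ^+ i * h.[- M + i%:R]) *+ 'C(N.*2, i).
have c0 : 0 < c by rewrite ltr0n bin_gt0; lia.
have G_bnd (i j : nat) : (0 < j <= N)%N -> - M + i%:R = j%:R \/ - M + i%:R = - j%:R ->
    `|G i| <= c * (B * M ^+ 2 * (j%:R ^+ 2)^-1).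
  move=> jN iE; rewrite /G normrMn normrM normrX normrN1 expr1n mul1r -[_ *+ 'C(_, _)]mulr_natl.
    have -> : h.[- M + i%:R] = h.[j%:R] by case: iE => ->; rewrite ?hN.

  by apply: ler_pM; rewrite ?ler0n ?normr_ge0 ?ler_nat ?leq_bin_central ?h_bnd.
have ltN2 : (N < N.*2.+1)%N by lia.
(* Both sides of the central term are numbered outward from it: index [i] stands for the sample
   points [- (i + 1)] and [i + 1]. *)
have sumG : \sum_(0 <= i < N) G (N - i.+1)%N + (G N + \sum_(0 <= i < N) G (i + N.+1)%N) = 0.
  rewrite -[RHS](alternating_binomial_horner_eq0 _ _ h (- M) sz_h) -/N.
  rewrite -(big_mkord xpredT G) [RHS](@big_cat_nat _ _ _ N) ?(ltnW ltN2) //.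
  rewrite (big_ltn ltN2).
  rewrite [in RHS]big_nat_rev /= add0n; congr (_ + (_ + _)).
  have := big_addn 0 N.*2.+1 N.+1 xpredT G; rewrite add0n => ->.
  by rewrite (_ : (N.*2.+1 - N.+1)%N = N) //; lia.
have GN : `|G N| = c * `|q`_1|.
  rewrite /G normrMn normrM normrX normrN1 expr1n mul1r addNr -[_ *+ 'C(_, _)]mulr_natl hE.
  by rewrite mul0r expr0n p0E.
have half_bnd (g : nat -> F) : (forall j, (j < N)%N ->
     `|g j| <= c * (B * M ^+ 2 * (j.+1%:R ^+ 2)^-1)) ->
   `|\sum_(0 <= j < N) g j| <= c * (B * M ^+ 2 * 2).
  move=> g_bnd; rewrite big_mkord; apply: (le_trans (ler_norm_sum _ _ _)).
  apply: (@le_trans _ _ (\sum_(j < N) c * (B * M ^+ 2 * (j.+1%:R ^+ 2)^-1))).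
    by apply: ler_sum => j _; apply: g_bnd.
  rewrite -!mulr_sumr ler_wpM2l ?(ltW c0) // ler_wpM2l ?sum_inv_sq_le2 //.
  by rewrite mulr_ge0 ?sqr_ge0.
(* Each half contributes a factor 2 from the sum of inverse squares; together they give the constant
   4. *)
have : `|G N| <= c * (B * M ^+ 2 * 2) + c * (B * M ^+ 2 * 2).
  have -> : G N = - (\sum_(0 <= i < N) G (N - i.+1)%N + \sum_(0 <= i < N) G (i + N.+1)%N).
    by apply/eqP; rewrite -addr_eq0 addrCA sumG.
  rewrite normrN; apply: (le_trans (ler_normD _ _)); apply: lerD.
    apply: half_bnd => j jN; apply: G_bnd => //; right.
    by rewrite natrB // addrA addNr add0r.
  apply: half_bnd => j jN; apply: G_bnd => //; left.
  by rewrite addnS -addSn natrD addrCA addNr addr0.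
rewrite GN -mulrDr ler_pM2l // => le_q1.
by apply: (le_trans (ler_norm _)); apply: (le_trans le_q1); rewrite -/M; lra.
Qed.

(** * Multilinear polynomials in indicator bits and their averages over random sets *)

(* [g] is a multilinear polynomial of degree at most [m] in the indicator bits
   of its argument: [S \subset X] is the monomial \prod_(i in S) [i \in X]. *)
Definition mdeg_le {I : finType} {F : nmodType} (m : nat) (g : {set I} -> F) : Prop :=
  exists2 l : seq (F * {set I}), (forall c, c \in l -> #|c.2| <= m)%N &
    forall X, g X = \sum_(c <- l) c.1 *+ (c.2 \subset X).

Lemma eq_mdeg_le {I : finType} {F : nmodType} (m : nat) (g h : {set I} -> F) :
  g =1 h -> mdeg_le m g -> mdeg_le m h.
Proof. by move=> eq_gh [l lm gE]; exists l => // X; rewrite -eq_gh. Qed.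

Lemma mdeg_le_cst {I : finType} {F : nmodType} (m : nat) (a : F) :
  mdeg_le m (fun _ : {set I} => a).
Proof.
exists [:: (a, set0)] => [c|X]; last by rewrite big_seq1 sub0set.
by rewrite inE => /eqP->; rewrite cards0.
Qed.

Lemma mdeg_le_mem {I : finType} {F : pzSemiRingType} (i : I) :
  mdeg_le 1 (fun X => (i \in X)%:R : F).
Proof.
exists [:: (1, [set i])] => [c|X]; last by rewrite big_seq1 sub1set.
by rewrite inE => /eqP->; rewrite cards1.
Qed.

Lemma mdeg_leD {I : finType} {F : nmodType} (m : nat) (g h : {set I} -> F) :
  mdeg_le m g -> mdeg_le m h -> mdeg_le m (fun X => g X + h X).
Proof.
move=> [l lm gE] [l' l'm hE]; exists (l ++ l') => [c|X].
  by rewrite mem_cat => /orP[/lm|/l'm].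
by rewrite big_cat gE hE.
Qed.

Lemma mdeg_le_sum {I J : finType} {F : nmodType} (m : nat) (P : pred J)
    (g : J -> {set I} -> F) :
  (forall j, P j -> mdeg_le m (g j)) -> mdeg_le m (fun X => \sum_(j | P j) g j X).
Proof.
move=> gm.
suff H (s : seq J) : mdeg_le m (fun X => \sum_(j <- s | P j) g j X) by exact: H.
elim: s => [|j s IHs].
  by apply: eq_mdeg_le (mdeg_le_cst m 0) => X; rewrite big_nil.
apply: (@eq_mdeg_le _ _ _ (fun X => (if P j then g j X else 0) + \sum_(k <- s | P k) g k X)).
  by move=> X; rewrite big_cons; case: (P j); rewrite ?add0r.
by apply: mdeg_leD => //; case Pj: (P j); [exact: gm|exact: mdeg_le_cst].
Qed.

(** Indicator bits are idempotent, so the monomials of two sets multiply to the monomial of their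
    union. *)
Lemma mdeg_leM {I : finType} {F : pzSemiRingType} (m m' : nat) (g h : {set I} -> F) :
  mdeg_le m g -> mdeg_le m' h -> mdeg_le (m + m') (fun X => g X * h X).
Proof.
move=> [l lm gE] [l' l'm hE].
exists [seq (c.1 * d.1, c.2 :|: d.2) | c <- l, d <- l'] => [_ /allpairsP[[c d] /= [lc ld ->]]|X] /=.
  by rewrite (leq_trans (leq_card_setU _ _)) // leq_add ?lm ?l'm.
rewrite gE hE big_allpairs_dep mulr_suml; apply: eq_bigr => c _.
rewrite mulr_sumr; apply: eq_bigr => d _.
by rewrite /= subUset -mulnb mulrnA mulrnAl mulrnAr mulrnAC.
Qed.

Lemma mdeg_leMl {I : finType} {F : pzSemiRingType} (m : nat) (a : F) (g : {set I} -> F) :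
  mdeg_le m g -> mdeg_le m (fun X => a * g X).
Proof. exact: (@mdeg_leM I F 0 m _ _ (@mdeg_le_cst I F 0 a)). Qed.

(** Additivity suffices because [phi] acts on the coefficients only; this serves for real and
    imaginary parts. *)
Lemma mdeg_le_morph {I : finType} {F G : nmodType} (m : nat) (phi : F -> G)
    (g : {set I} -> F) :
  phi 0 = 0 -> {morph phi : x y / x + y} -> mdeg_le m g -> mdeg_le m (fun X => phi (g X)).
Proof.
move=> phi0 phiD [l lm gE]; exists [seq (phi c.1, c.2) | c <- l] => [_ /mapP[c lc ->]|X].
  exact: lm.
by rewrite gE big_map (big_morph phi phiD phi0); apply: eq_bigr => c _; case: (_ \subset _).
Qed.

(** For [t] in [[0, 1]], the probability of drawing [X] when each element is kept independently with
    probability [t]. *)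
Definition bernoulli_weight {I : finType} {F : pzRingType} (t : F) (X : {set I}) : F :=
  \prod_i (if i \in X then t else 1 - t).

(** Expand the product over [i] of [t + (if i \in S then 0 else 1 - t)]: the choices that omit an
    element of [S] vanish. *)
Lemma sum_bernoulli_weight_subset {I : finType} {F : comPzRingType} (t : F) (S : {set I}) :
  \sum_(X : {set I}) bernoulli_weight t X *+ (S \subset X) = t ^+ #|S|.
Proof.
have -> : t ^+ #|S| = \prod_i (t + (if i \in S then 0 else 1 - t)).
  rewrite (bigID [in S]) /= [X in _ * X]big1 ?mulr1; last first.
    by move=> i /negPf->; rewrite addrC subrK.
  by rewrite -prodr_const; apply: eq_bigr => i ->; rewrite addr0.
rewrite bigA_distr; apply: eq_bigr => X _ /=.
have [/subsetP sSX|/subsetPn[i iS iX]] := boolP (S \subset X).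
  apply: eq_bigr => i _; case: ifP => // iX; case: ifP => // /sSX; by rewrite iX.
by rewrite mulr0n (bigD1 i) //= (negPf iX) iS mul0r.
Qed.

(* The expectation of [f] over random sets with independent elements of
   probability [t] is a polynomial in [t], bounded on [0, 1], with slope
   [\sum_i (f [set i] - f set0)] at the origin. *)
Lemma sum_set1_diff_le {I : finType} {F : realFieldType} (m : nat)
    (f : {set I} -> F) (B : F) :
  mdeg_le m f -> (forall X, 0 <= f X <= B) ->
  \sum_i (f [set i] - f set0) <= 4 * m%:R ^+ 2 * B.
Proof.
move=> [l lm fE] f_bnd.
(* Averaging turns the monomial of a set [S] into [t ^+ #|S|]. *)
pose q : {poly F} := \sum_(c <- l) c.1 *: 'X^#|c.2|.
have sz_q : (size q <= m.+1)%N.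
  rewrite /q big_seq; apply: (big_ind (fun p : {poly F} => size p <= m.+1)%N).
  - by rewrite size_poly0.
  - by move=> p r pm rm; rewrite (leq_trans (size_polyD _ _)) // geq_max pm.
  - move=> c lc; apply: (leq_trans (size_scale_leq _ _)).
    by rewrite size_polyXn ltnS lm.
have qE t : q.[t] = \sum_(X : {set I}) bernoulli_weight t X * f X.
  under eq_bigr do rewrite fE mulr_sumr.
  rewrite exchange_big /= horner_sum; apply: eq_bigr => c _.
  rewrite hornerZ hornerXn -sum_bernoulli_weight_subset mulr_sumr.
  by apply: eq_bigr => X _; rewrite !mulrnAr mulrC.
suff <- : q`_1 = \sum_i (f [set i] - f set0).
  apply: coef1_le_of_bounded => // t /andP[t0 t1]; rewrite qE.
  have w0 (X : {set I}) : 0 <= bernoulli_weight t X.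
    by apply: prodr_ge0 => i _; case: ifP => _ //; rewrite subr_ge0.
  apply/andP; split.
    by apply: sumr_ge0 => X _; rewrite mulr_ge0 //; case/andP: (f_bnd X).
  have w1 : \sum_(X : {set I}) bernoulli_weight t X = 1.
    rewrite -[RHS](expr0 t) -(cards0 I) -sum_bernoulli_weight_subset.
    by apply: eq_bigr => X _; rewrite sub0set.
  rewrite -[B]mul1r -w1 mulr_suml; apply: ler_sum => X _.
  by rewrite ler_wpM2l //; case/andP: (f_bnd X).
(* Compare monomial by monomial: the empty set cancels in every difference, a singleton survives in
   exactly one, and a larger set in none. *)
under [RHS]eq_bigr do rewrite !fE -sumrB.
rewrite exchange_big /= coef_sum; apply: eq_bigr => c _.
rewrite coefZ coefXn; under [RHS]eq_bigr do rewrite subset0.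
have [S0|S0] := eqVneq c.2 set0.
  by rewrite S0 cards0 mulr0 big1 // => i _; rewrite sub0set subrr.
have [|S1] := boolP (#|c.2| == 1)%N.
  move=> /cards1P[i Si]; rewrite Si cards1 mulr1 (bigD1 i) //= subxx big1 ?subr0 ?addr0 //.
  by move=> j ji; rewrite sub1set inE eq_sym (negPf ji) subr0.
rewrite eq_sym (negPf S1) mulr0 big1 // => i _.
rewrite subset1 (negPf S0) orbF subr0; case: eqVneq => // Si.
by rewrite Si cards1 in S1.
Qed.

(** * Adjoints, orthogonal projectors and the Frobenius norm *)

Section FrobeniusNorm.
Context {R : realType}.
Local Notation C := R[i].

(** The square of the Frobenius norm, summed by columns so that bounds on vectors apply to each
    column. *)
Definition frob {p q : nat} (A : 'M[C]_(p, q)) : R := \sum_j sqnorm (col j A).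

Lemma adjmxM {p q r : nat} (A : 'M[C]_(p, q)) (B : 'M[C]_(q, r)) :
  adjmx (A *m B) = adjmx B *m adjmx A.
Proof. by rewrite /adjmx map_mxM trmx_mul. Qed.

Lemma adjmxK {p q : nat} (A : 'M[C]_(p, q)) : adjmx (adjmx A) = A.
Proof. by apply/matrixP => i j; rewrite !mxE conjCK. Qed.

Lemma adjmxD {p q : nat} (A B : 'M[C]_(p, q)) : adjmx (A + B) = adjmx A + adjmx B.
Proof. by rewrite /adjmx map_mxD linearD. Qed.

Lemma adjmxB {p q : nat} (A B : 'M[C]_(p, q)) : adjmx (A - B) = adjmx A - adjmx B.
Proof. by rewrite /adjmx map_mxB linearB. Qed.

Lemma adjmxZ {p q : nat} (a : C) (A : 'M[C]_(p, q)) : adjmx (a *: A) = Num.conj a *: adjmx A.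
Proof. by rewrite /adjmx map_mxZ linearZ. Qed.

Lemma adjmx_scalar {d : nat} (a : C) : adjmx (a%:M : 'M[C]_d) = (Num.conj a)%:M.
Proof. by rewrite /adjmx map_scalar_mx tr_scalar_mx. Qed.

Lemma adjmx1 {d : nat} : adjmx (1%:M : 'M[C]_d) = 1%:M.
Proof. by rewrite adjmx_scalar rmorph1. Qed.

Lemma adjmx_tens {p q r s : nat} (A : 'M[C]_(p, q)) (B : 'M[C]_(r, s)) :
  adjmx (A *t B) = adjmx A *t adjmx B.
Proof. by rewrite /adjmx map_mxT trmx_tens. Qed.

Lemma innerE {d : nat} (u v : 'cV[C]_d) : inner u v = (adjmx u *m v) 0 0.
Proof. by rewrite mxE; apply: eq_bigr => i _; rewrite !mxE. Qed.

Lemma sqnormE {d : nat} (v : 'cV[C]_d) : (sqnorm v)%:C%C = (adjmx v *m v) 0 0.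
Proof.
rewrite mxE rmorph_sum; apply: eq_bigr => i _.
by rewrite [LHS]add_Re2_Im2 normCK !mxE mulrC.
Qed.

Lemma sqnorm_ge0 {d : nat} (v : 'cV[C]_d) : 0 <= sqnorm v.
Proof. by apply: sumr_ge0 => i _; rewrite addr_ge0 ?sqr_ge0. Qed.

Lemma sqnorm0 {d : nat} : sqnorm (0 : 'cV[C]_d) = 0.
Proof. by rewrite /sqnorm big1 // => i _; rewrite mxE /= expr0n addr0. Qed.

Lemma sqnorm_eq0 {d : nat} (v : 'cV[C]_d) : sqnorm v = 0 -> v = 0.
Proof.
move=> /psumr_eq0P v0; apply/matrixP => i j; rewrite ord1 mxE.
have /v0 : forall k : 'I_d, true -> 0 <= complex.Re (v k 0) ^+ 2 + complex.Im (v k 0) ^+ 2.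
  by move=> k _; rewrite addr_ge0 ?sqr_ge0.
move=> /(_ i isT)/(congr1 (real_complex R)); rewrite add_Re2_Im2 => /eqP.
by rewrite sqrf_eq0 normr_eq0 => /eqP.
Qed.

Lemma sqnormZ {d : nat} (a : C) (v : 'cV[C]_d) :
  (sqnorm (a *: v))%:C%C = `|a| ^+ 2 * (sqnorm v)%:C%C.
Proof.
by rewrite !sqnormE adjmxZ -scalemxAl -scalemxAr scalerA mxE normCK [a * _]mulrC.
Qed.

Lemma sqnormD_orth {d : nat} (u v : 'cV[C]_d) : inner u v = 0 ->
  sqnorm (u + v) = sqnorm u + sqnorm v.
Proof.
move=> uv; apply: (@complexI R); rewrite rmorphD /= !sqnormE.
have uv0 : adjmx u *m v = 0 by apply/matrixP => i j; rewrite !ord1 -innerE uv mxE.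
have vu0 : adjmx v *m u = 0 by rewrite -[u]adjmxK -adjmxM uv0 /adjmx map_mx0 trmx0.
by rewrite adjmxD mulmxDl !mulmxDr uv0 vu0 addr0 add0r [LHS]mxE.
Qed.

Lemma sqnormD_le {d : nat} (u v : 'cV[C]_d) : sqnorm (u + v) <= 2 * sqnorm u + 2 * sqnorm v.
Proof.
rewrite /sqnorm !mulr_sumr -big_split /=; apply: ler_sum => i _.
rewrite mxE; case: (u i 0) => a b; case: (v i 0) => c e /=.
have := sqr_ge0 (a - c); have := sqr_ge0 (b - e); nra.
Qed.

Lemma sqnorm_isometry {p q : nat} (U : 'M[C]_(p, q)) (v : 'cV[C]_q) :
  adjmx U *m U = 1%:M -> sqnorm (U *m v) = sqnorm v.
Proof.
move=> UU; apply: (@complexI R).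
by rewrite !sqnormE adjmxM mulmxA -[_ *m _ *m U]mulmxA UU mulmx1.
Qed.

Lemma sqnorm_projector {d : nat} (Q : 'M[C]_d) (v : 'cV[C]_d) : orth_projector Q ->
  sqnorm v = sqnorm (Q *m v) + sqnorm (v - Q *m v).
Proof.
move=> [QQ Qa]; rewrite -sqnormD_orth; first by rewrite [Q *m v + _]addrC subrK.
rewrite innerE.
by rewrite adjmxM Qa mulmxBr -!mulmxA [Q *m (Q *m v)]mulmxA QQ subrr mxE.
Qed.

Lemma sqnorm_projector_le {d : nat} (Q : 'M[C]_d) (v : 'cV[C]_d) : orth_projector Q ->
  sqnorm (Q *m v) <= sqnorm v.
Proof. by move=> /(sqnorm_projector _ v) ->; rewrite lerDl sqnorm_ge0. Qed.

Lemma frobE {p q : nat} (A : 'M[C]_(p, q)) : (frob A)%:C%C = \tr (adjmx A *m A).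
Proof.
rewrite rmorph_sum; apply: eq_bigr => j _ /=; rewrite sqnormE !mxE.
by apply: eq_bigr => i _; rewrite !mxE.
Qed.

Lemma frob_ge0 {p q : nat} (A : 'M[C]_(p, q)) : 0 <= frob A.
Proof. by apply: sumr_ge0 => j _; apply: sqnorm_ge0. Qed.

Lemma frob_adj {p q : nat} (A : 'M[C]_(p, q)) : frob (adjmx A) = frob A.
Proof. by apply: (@complexI R); rewrite !frobE adjmxK mxtrace_mulC. Qed.

Lemma col_mulmx {p q r : nat} (A : 'M[C]_(p, q)) (B : 'M[C]_(q, r)) (j : 'I_r) :
  col j (A *m B) = A *m col j B.
Proof. by rewrite !colE mulmxA. Qed.

Lemma frob_projector_le {d q : nat} (Q : 'M[C]_d) (A : 'M[C]_(d, q)) :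
  orth_projector Q -> frob (Q *m A) <= frob A.
Proof. by move=> Qp; apply: ler_sum => j _; rewrite col_mulmx sqnorm_projector_le. Qed.

Lemma orth_projector_rank1 {d : nat} (w : 'cV[C]_d) : sqnorm w = 1 ->
  orth_projector (w *m adjmx w).
Proof.
move=> w1; split; last by rewrite adjmxM adjmxK.
rewrite mulmxA -[_ *m _ *m w]mulmxA.
by rewrite [adjmx w *m w]mx11_scalar -sqnormE w1 rmorph1 mulmx1.
Qed.

Lemma frob_rank1 {d : nat} (w : 'cV[C]_d) : sqnorm w = 1 -> frob (w *m adjmx w) = 1.
Proof.
move=> w1; have [WW Wa] := orth_projector_rank1 _ w1; apply: (@complexI R).
by rewrite frobE Wa WW mxtrace_mulC trace_mx11 -sqnormE w1.
Qed.

(** The left side is [frob] of the adjoint of [A] multiplied by the rank one projector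
    [w *m adjmx w], and a projector does not increase [frob]. *)
Lemma sqnorm_mul_unit_le_frob {p d : nat} (A : 'M[C]_(p, d)) (w : 'cV[C]_d) :
  sqnorm w = 1 -> sqnorm (A *m w) <= frob A.
Proof.
move=> w1; have W := orth_projector_rank1 _ w1.
have -> : sqnorm (A *m w) = frob (w *m adjmx w *m adjmx A).
  apply: (@complexI R); rewrite -frob_adj !adjmxM !adjmxK frobE !adjmxM !adjmxK.
  rewrite sqnormE adjmxM !mulmxA -!mulmxA (mxtrace_mulC w) !mulmxA.
  rewrite -[LHS]trace_mx11; congr (\tr _); rewrite -!mulmxA [adjmx w *m w]mx11_scalar.
  by rewrite -sqnormE w1 rmorph1 mulmx1.
by rewrite -[leRHS]frob_adj frob_projector_le.
Qed.

(** Gram-Schmidt: each vector is split by the current projector, and a nonzero residual, once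
    normalized, adds a rank one projector. For an orthogonal projector [frob] is the trace, hence
    the rank, so the bound by [m] does not involve [d]. *)
Lemma exists_projector_fixing {d m : nat} (w : 'I_m -> 'cV[C]_d) :
  exists Q : 'M[C]_d, [/\ orth_projector Q, frob Q <= m%:R & forall i, Q *m w i = w i].
Proof.
elim: m w => [|m IHm] w.
  exists 0; split; last by case.
  - by split; rewrite ?mul0mx // /adjmx map_mx0 trmx0.
  - by rewrite /frob big1 // => j _; rewrite col0 sqnorm0.
have [Q [[QQ Qa] Qm Qw]] := IHm (fun i => w (lift ord0 i)).
pose v := w ord0; pose u := v - Q *m v.
have Qu : Q *m u = 0 by rewrite mulmxBr mulmxA QQ subrr.
have uQ : adjmx u *m Q = 0 by rewrite -Qa -adjmxM Qu /adjmx map_mx0 trmx0.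
have [u0|u0] := eqVneq (sqnorm u) 0.
  exists Q; split => //; first by apply: (le_trans Qm); rewrite ler_nat.
  move=> i; case: (unliftP ord0 i) => [j|] ->; first exact: Qw.
  by move/sqnorm_eq0/eqP: u0; rewrite subr_eq0 => /eqP.
have u0' : 0 < sqnorm u by rewrite lt_def u0 sqnorm_ge0.
pose s : C := (Num.sqrt (sqnorm u))^-1%:C%C; pose e := s *: u.
have e1 : sqnorm e = 1.
  apply: (@complexI R); rewrite sqnormZ.
  have -> : `|s| = s by rewrite ger0_norm // ler0c invr_ge0 sqrtr_ge0.
  by rewrite -rmorphXn -rmorphM exprVn sqr_sqrtr ?sqnorm_ge0 // mulVf.
have Qe : Q *m e = 0 by rewrite -scalemxAr Qu scaler0.
have eQ : adjmx e *m Q = 0 by rewrite adjmxZ -scalemxAl uQ scaler0.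
have [EE Ea] := orth_projector_rank1 _ e1.
have Q'p : orth_projector (Q + e *m adjmx e).
  split; last by rewrite adjmxD Qa Ea.
  by rewrite mulmxDl !mulmxDr QQ EE mulmxA Qe mul0mx addr0 -mulmxA eQ mulmx0 add0r.
exists (Q + e *m adjmx e); split => //.
  rewrite -natr1; apply: (@le_trans _ _ (frob Q + frob (e *m adjmx e))); last first.
    by rewrite lerD // frob_rank1.
  (* Equality holds: on projectors [frob] is the trace, which is additive. *)
  rewrite le_eqVlt; apply/orP; left; apply/eqP/(@complexI R).
  by rewrite rmorphD /= !frobE Q'p.2 Q'p.1 Qa QQ Ea EE mxtraceD.
have uE : u = s^-1 *: e.
  rewrite scalerA mulVf ?scale1r // /s eq_complex /= eqxx andbT.
  by rewrite invr_eq0 sqrtr_eq0 -ltNge.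
have eu : e *m (adjmx e *m u) = u.
  rewrite uE; clearbody e; rewrite -!scalemxAr [adjmx e *m e]mx11_scalar.
  by rewrite -sqnormE e1 rmorph1 mulmx1.
move=> i; case: (unliftP ord0 i) => [j|] ->.
  rewrite mulmxDl Qw -[in X in _ + X](Qw j) mulmxA -[e *m _ *m Q]mulmxA eQ.
  by rewrite mulmx0 mul0mx addr0.
have vE : v = u + Q *m v by rewrite subrK.
rewrite -/v mulmxDl [in X in _ + X]vE -mulmxA mulmxDr mulmxA eQ mul0mx addr0 eu.
by rewrite addrC -vE.
Qed.

(** Split each column of [Q] along [w] and its orthogonal complement. The parts along [w] have total
    squared norm at most 1 and [T] is a contraction on them; on the complement [T] gains the factor
    [eps]. The factors 2 come from [sqnormD_le]. *)
Lemma frob_unique_le {p d : nat} (T : 'M[C]_(p, d)) (Q : 'M[C]_d) (w : 'cV[C]_d) (eps : R) :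
  (forall v, sqnorm (T *m v) <= sqnorm v) -> sqnorm w = 1 -> 0 <= eps ->
  (forall v, inner w v = 0 -> sqnorm (T *m v) <= eps * sqnorm v) ->
  orth_projector Q -> frob (T *m Q) <= 2 + 2 * eps * frob Q.
Proof.
move=> T1 w1 eps0 Teps Qp; have W := orth_projector_rank1 _ w1.
set E := w *m adjmx w in W.
have frobEQ : frob (E *m Q) <= 1.
  by rewrite -frob_adj adjmxM W.2 Qp.2 -[leRHS](frob_rank1 _ w1) frob_projector_le.
apply: (@le_trans _ _ (2 * frob (E *m Q) + 2 * eps * frob Q)); last by lra.
rewrite /frob !mulr_sumr -big_split /=; apply: ler_sum => j _.
rewrite !col_mulmx; set b := col j Q.
have {1}-> : b = E *m b + (b - E *m b) by rewrite addrC subrK.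
rewrite mulmxDr.
apply: (le_trans (sqnormD_le _ _)); apply: lerD; first by rewrite ler_wpM2l ?T1.
rewrite -mulrA ler_wpM2l //; apply: (le_trans (Teps _ _)).
  rewrite innerE mulmxBr /E !mulmxA [adjmx w *m w]mx11_scalar -sqnormE w1.
  by rewrite rmorph1 mul1mx subrr mxE.
by rewrite ler_wpM2l // (sqnorm_projector _ b W) lerDr sqnorm_ge0.
Qed.

End FrobeniusNorm.

(** * The verifier as a linear operator on witnesses *)

Section QueryAlgorithm.
Context {R : realType}.
Local Notation C := R[i].

Lemma tensmxDl {p q r s : nat} (A B : 'M[C]_(p, q)) (D : 'M[C]_(r, s)) :
  (A + B) *t D = A *t D + B *t D.
Proof. by apply/matrixP => i j; rewrite !mxE mulrDl. Qed.

Lemma tensmx1 {p q : nat} : (1%:M : 'M[C]_p) *t (1%:M : 'M[C]_q) = 1%:M.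
Proof.
apply/matrixP => i j; case: (mxtens_indexP i) => i1 i2; case: (mxtens_indexP j) => j1 j2.
by rewrite tensmxE !mxE (inj_eq (can_inj (@mxtens_indexK _ _))) xpair_eqE -natrM mulnb.
Qed.

Lemma sqnorm_tens {p q : nat} (u : 'cV[C]_p) (v : 'cV[C]_q) :
  sqnorm (u *t v : 'cV[C]_(p * q)) = sqnorm u * sqnorm v.
Proof.
rewrite /sqnorm mulr_sum; apply: eq_bigr => i _; rewrite mxE !ord1.
by case: (u _ _) => x y; case: (v _ _) => z t /=; ring.
Qed.

Lemma sqnorm_delta {d : nat} (i : 'I_d) : sqnorm (delta_mx i 0 : 'cV[C]_d) = 1.
Proof.
apply: (@complexI R); rewrite sqnormE /adjmx map_delta_mx trmx_delta mul_delta_mx.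
by rewrite mxE !eqxx.
Qed.

Lemma orth_projector1 {d : nat} : orth_projector (1%:M : 'M[C]_d).
Proof. by split; rewrite ?mulmx1 ?adjmx1. Qed.

Lemma orth_projector_tens {p q : nat} (P : 'M[C]_p) (Q : 'M[C]_q) :
  orth_projector P -> orth_projector Q -> orth_projector (P *t Q).
Proof. by move=> [PP Pa] [QQ Qa]; split; rewrite ?tensmx_mul ?adjmx_tens ?PP ?QQ ?Pa ?Qa. Qed.

Lemma adjmx_delta {p q : nat} (i : 'I_p) (j : 'I_q) :
  adjmx (delta_mx i j : 'M[C]_(p, q)) = delta_mx j i.
Proof. by rewrite /adjmx map_delta_mx trmx_delta. Qed.

Lemma orth_projector_out1 (w a n : nat) : orth_projector (out1_proj R w a n).
Proof.
apply: orth_projector_tens; last exact: orth_projector1.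
apply: orth_projector_tens; last exact: orth_projector1.
apply: orth_projector_tens; first exact: orth_projector1.
by split; rewrite ?mul_delta_mx ?adjmx_delta.
Qed.

Lemma reflection_adjmul {d : nat} (P : 'M[C]_d) : orth_projector P ->
  adjmx (1%:M - 2%:R *: P) *m (1%:M - 2%:R *: P) = 1%:M.
Proof.
move=> [PP Pa]; rewrite adjmxB adjmx1 adjmxZ Pa rmorph_nat.
rewrite mulmxBl !mulmxBr !mul1mx mulmx1 -scalemxAl -scalemxAr PP scalerA.
by apply/matrixP => i j; rewrite !mxE; ring.
Qed.

Lemma ctrl_query_adjmul {w a n : nat} (P : 'M[C]_(Kdim w a)) (O : 'M[C]_(2 ^ n)) :
  orth_projector P -> adjmx O *m O = 1%:M ->
  adjmx (ctrl_query P O) *m ctrl_query P O = 1%:M.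
Proof.
move=> [PP Pa] OO; rewrite /ctrl_query adjmxD !adjmx_tens adjmxB !adjmx1 Pa.
have NP : (1%:M - P) *m P = 0 by rewrite mulmxBl mul1mx PP subrr.
have PN : P *m (1%:M - P) = 0 by rewrite mulmxBr mulmx1 PP subrr.
have NN : (1%:M - P) *m (1%:M - P) = 1%:M - P.
  by rewrite {1}mulmxBl mul1mx PN subr0.
rewrite mulmxDl !mulmxDr !tensmx_mul NN NP PN PP !tens0mx mulmx1 OO.
by rewrite addr0 add0r -tensmxDl subrK tensmx1.
Qed.

Lemma sqnorm_run_state {n w a L : nat} (V : verifier R n w a) (O : 'M[C]_(2 ^ n))
    (psi : 'cV[C]_(Ddim w a n)) (j : nat) :
  valid_verifier L V -> adjmx O *m O = 1%:M -> (j <= L)%N ->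
  sqnorm (run_state V O psi j) = sqnorm psi.
Proof.
move=> [VU VP] OO; elim: j => [|j IHj] jL /=; first by rewrite sqnorm_isometry //; case: (VU 0 jL).
rewrite sqnorm_isometry; last by case: (VU _ jL).
rewrite sqnorm_isometry ?IHj ?(ltnW jL) //.
by apply: ctrl_query_adjmul => //; apply: VP.
Qed.

Lemma sqnorm_init_state {w : nat} (a n : nat) (omega : 'cV[C]_(2 ^ w)) :
  sqnorm (init_state a n omega) = sqnorm omega.
Proof.
rewrite /init_state sqnorm_tens [X in X * _]sqnorm_tens [X in X * _ * _]sqnorm_tens.
by rewrite !sqnorm_delta !mulr1.
Qed.

(** The isometry that adjoins the initialized auxiliary register, given by its columns. *)
Definition init_mx (w a n : nat) : 'M[C]_(Ddim w a n, 2 ^ w) :=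
  \matrix_(i, j) init_state a n (delta_mx j 0 : 'cV[C]_(2 ^ w)) i 0.

Lemma init_stateE {w : nat} (a n : nat) (omega : 'cV[C]_(2 ^ w)) :
  init_state a n omega = init_mx w a n *m omega.
Proof.
apply/matrixP => i j; rewrite ord1 [RHS]mxE !mxE !ord1.
(* [x] is the witness coordinate of the row index [i]; only column [x] can be nonzero in this
   row. *)
set x := (mxtens_unindex (mxtens_unindex (mxtens_unindex i).1).1).1.
rewrite (bigD1 x) //= big1 ?addr0 => [|k kx]; rewrite !mxE !ord1 -/x ?eqxx.
  by rewrite mul1r; ring.
by rewrite eq_sym (negPf kx) !mul0r.
Qed.

Fixpoint run_mx {n w a : nat} (V : verifier R n w a) (O : 'M[C]_(2 ^ n)) (j : nat)
    : 'M[C]_(Ddim w a n) :=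
  if j is j'.+1 then vU V j *m (ctrl_query (vPi V j) O *m run_mx V O j') else vU V 0.

Lemma run_stateE {n w a : nat} (V : verifier R n w a) (O : 'M[C]_(2 ^ n))
    (psi : 'cV[C]_(Ddim w a n)) (j : nat) :
  run_state V O psi j = run_mx V O j *m psi.
Proof. by elim: j => //= j ->; rewrite !mulmxA. Qed.

(** The operator written T_X in the overview, here for an arbitrary oracle. *)
Definition accept_mx {n w a : nat} (L : nat) (V : verifier R n w a) (O : 'M[C]_(2 ^ n))
    : 'M[C]_(Ddim w a n, 2 ^ w) :=
  out1_proj R w a n *m (run_mx V O L *m init_mx w a n).

Lemma accept_probE {n w a : nat} (L : nat) (V : verifier R n w a) (O : 'M[C]_(2 ^ n))
    (omega : 'cV[C]_(2 ^ w)) :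
  accept_prob L V O omega = sqnorm (accept_mx L V O *m omega).
Proof. by rewrite /accept_prob run_stateE init_stateE /accept_mx !mulmxA. Qed.

Lemma accept_mx_contraction {n w a L : nat} (V : verifier R n w a) (O : 'M[C]_(2 ^ n))
    (omega : 'cV[C]_(2 ^ w)) :
  valid_verifier L V -> adjmx O *m O = 1%:M ->
  sqnorm (accept_mx L V O *m omega) <= sqnorm omega.
Proof.
move=> VV OO; rewrite -accept_probE /accept_prob -(sqnorm_init_state a n).
rewrite -[leRHS](sqnorm_run_state _ _ _ _ VV OO (leqnn L)).
exact: sqnorm_projector_le (orth_projector_out1 w a n).
Qed.

End QueryAlgorithm.

(** * Reflections about coordinate subspaces, and the polynomial method *)

Section SubsetOracle.
Context {R : realType}.
Local Notation C := R[i].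

(** Projectors onto spans of basis vectors are linear in the indicator bits of [X], which is what
    gives each query degree 1. *)
Definition subset_proj {m d : nat} (le_md : (m <= d)%N) (X : {set 'I_m}) : 'M[C]_d :=
  \sum_(x in X) delta_mx (widen_ord le_md x) (widen_ord le_md x).

Definition subset_oracle {m d : nat} (le_md : (m <= d)%N) (X : {set 'I_m}) : 'M[C]_d :=
  1%:M - 2%:R *: subset_proj le_md X.

Lemma subset_proj_orth {m d : nat} (le_md : (m <= d)%N) (X : {set 'I_m}) :
  orth_projector (subset_proj le_md X).
Proof.
have widen_inj : injective (widen_ord le_md) by move=> x y /(congr1 val) /= /val_inj.
split.
  rewrite /subset_proj mulmx_suml; apply: eq_bigr => x xX.
  rewrite mulmx_sumr (bigD1 x) //= big1 => [|y /andP[_ yx]].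
    by rewrite mul_delta_mx addr0.
  by rewrite mul_delta_mx_cond (inj_eq widen_inj) eq_sym (negPf yx).
apply/matrixP => i j; rewrite !mxE /subset_proj !summxE rmorph_sum.
by apply: eq_bigr => x _; rewrite !mxE /= rmorph_nat andbC.
Qed.

Lemma subset_proj_rank {m d : nat} (le_md : (m <= d)%N) (X : {set 'I_m}) :
  X != set0 -> (0 < \rank (subset_proj le_md X) <= m)%N.
Proof.
move=> /set0Pn[x xX]; apply/andP; split.
  (* The diagonal entry at an element of [X] is nonzero. *)
  rewrite lt0n mxrank_eq0; apply/eqP => /(congr1 (fun A : 'M[C]_d =>
    A (widen_ord le_md x) (widen_ord le_md x))).
  rewrite mxE summxE (bigD1 x) //= mxE !eqxx /= => /eqP.
  rewrite paddr_eq0 ?ler01 ?oner_eq0 //.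
  by apply: sumr_ge0 => y _; rewrite mxE ler0n.
apply: (@leq_trans #|X|); last by rewrite -[leqRHS]card_ord max_card.
rewrite -sum1_card /subset_proj.
apply: (big_ind2 (fun (A : 'M[C]_d) (r : nat) => \rank A <= r)%N).
- by rewrite mxrank0.
- by move=> A r B s Ar Bs; rewrite (leq_trans (mxrank_add _ _)) // leq_add.
- by move=> y _; rewrite mxrank_delta.
Qed.

Lemma mdeg_le_mulmx {I : finType} {p q r m m' : nat} (A : {set I} -> 'M[C]_(p, q))
    (B : {set I} -> 'M[C]_(q, r)) :
  (forall i j, mdeg_le m (fun X => A X i j)) ->
  (forall i j, mdeg_le m' (fun X => B X i j)) ->
  forall i j, mdeg_le (m + m') (fun X => (A X *m B X) i j).
Proof.
move=> Am Bm i j.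
apply: (@eq_mdeg_le _ _ _ (fun X => \sum_k A X i k * B X k j)); first by move=> X; rewrite mxE.
by apply: mdeg_le_sum => k _; apply: mdeg_leM.
Qed.

(** The degree doubles because [frob] is quadratic in the real and imaginary parts of the
    entries. *)
Lemma mdeg_le_frob {I : finType} {p q m : nat} (A : {set I} -> 'M[C]_(p, q)) :
  (forall i j, mdeg_le m (fun X => A X i j)) -> mdeg_le (m + m) (fun X => frob (A X)).
Proof.
move=> Am; apply: mdeg_le_sum => j _; apply: mdeg_le_sum => i _.
apply: (@eq_mdeg_le _ _ _ (fun X => complex.Re (A X i j) * complex.Re (A X i j) +
    complex.Im (A X i j) * complex.Im (A X i j))); first by move=> X; rewrite mxE !expr2.
by apply: mdeg_leD; apply: mdeg_leM; apply: mdeg_le_morph => // [[? ?]] [].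
Qed.

Lemma mdeg_le_subset_oracle {m d : nat} (le_md : (m <= d)%N) i j :
  mdeg_le 1 (fun X : {set 'I_m} => subset_oracle le_md X i j).
Proof.
apply: (@eq_mdeg_le _ _ _ (fun X : {set 'I_m} => (1%:M : 'M[C]_d) i j +
    \sum_x (- 2 * (delta_mx (widen_ord le_md x) (widen_ord le_md x) : 'M[C]_d) i j) *
           (x \in X)%:R)).
  move=> X; rewrite !mxE summxE mulr_sumr -sumrN big_mkcond [in RHS]big_mkcond /=.
  by congr (_ + _); apply: eq_bigr => x _; case: ifP => _; rewrite ?mulr1 ?mulr0 ?mulNr.
apply: mdeg_leD; first exact: mdeg_le_cst.
by apply: mdeg_le_sum => x _; apply: mdeg_leMl; apply: mdeg_le_mem.
Qed.

Lemma mdeg_le_ctrl_query {m w a n : nat} (le_m : (m <= 2 ^ n)%N) (P : 'M[C]_(Kdim w a)) i j :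
  mdeg_le 1 (fun X : {set 'I_m} => ctrl_query P (subset_oracle le_m X) i j).
Proof.
pose O (X : {set 'I_m}) := subset_oracle le_m X.
apply: (@eq_mdeg_le _ _ _ (fun X => ((1%:M - P) *t (1%:M : 'M[C]_(2 ^ n))) i j +
    P (mxtens_unindex i).1 (mxtens_unindex j).1 *
    O X (mxtens_unindex i).2 (mxtens_unindex j).2)).
  by move=> X; rewrite /ctrl_query [RHS]mxE [X in _ = _ + X]mxE.
apply: mdeg_leD; first exact: mdeg_le_cst.
by apply: mdeg_leMl; apply: mdeg_le_subset_oracle.
Qed.

(** Each query raises the degree by at most one; all other factors are independent of [X]. *)
Lemma mdeg_le_accept_mx {m n w a : nat} (L : nat) (V : verifier R n w a)
    (le_m : (m <= 2 ^ n)%N) i j :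
  mdeg_le L (fun X : {set 'I_m} => accept_mx L V (subset_oracle le_m X) i j).
Proof.
have cst (p q : nat) (A : 'M[C]_(p, q)) x y : mdeg_le 0 (fun _ : {set 'I_m} => A x y).
  exact: mdeg_le_cst.
apply: (@mdeg_le_mulmx _ _ _ _ 0 L (fun=> _)) => {i j} [|i j]; first exact: cst.
rewrite -[X in mdeg_le X]addn0.
apply: (@mdeg_le_mulmx _ _ _ _ L 0 _ (fun=> _)) => {i j} [|i j]; last exact: cst.
elim: L => [|L IHL] i j /=; first exact: cst.
apply: (@mdeg_le_mulmx _ _ _ _ 0 L.+1 (fun=> _)) => {i j} [|i j]; first exact: cst.
exact: (@mdeg_le_mulmx _ _ _ _ 1 L) (mdeg_le_ctrl_query le_m _) IHL i j.
Qed.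

(** Rescaling carries bounds on unit witnesses over to all vectors, such as the columns of a
    projector. *)
Lemma sqnorm_homogeneous_le {p d : nat} (T : 'M[C]_(p, d)) (w : 'cV[C]_d) (eps : R) :
  (forall v, sqnorm v = 1 -> inner w v = 0 -> sqnorm (T *m v) <= eps) ->
  forall v, inner w v = 0 -> sqnorm (T *m v) <= eps * sqnorm v.
Proof.
move=> Teps v wv; have [v0|v0] := eqVneq (sqnorm v) 0.
  by rewrite v0 mulr0 (sqnorm_eq0 _ v0) mulmx0 sqnorm0.
have v_gt0 : 0 < sqnorm v by rewrite lt_def v0 sqnorm_ge0.
pose s : R := (Num.sqrt (sqnorm v))^-1.
have sZ (q : nat) (u : 'cV[C]_q) : sqnorm (s%:C%C *: u) = (sqnorm v)^-1 * sqnorm u.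
  apply: (@complexI R); rewrite sqnormZ ger0_norm; last by rewrite ler0c invr_ge0 sqrtr_ge0.
  by rewrite -rmorphXn -rmorphM exprVn sqr_sqrtr ?sqnorm_ge0.
have := Teps (s%:C%C *: v); rewrite -scalemxAr !sZ mulVf // => /(_ erefl).
rewrite ler_pdivrMl // mulrC; apply.
by rewrite innerE -scalemxAr mxE -innerE wv mulr0.
Qed.

(** The left side bounds from below the sum of the [2 ^ k] increments of f from the empty set to a
    singleton; the right side is the bound of [sum_set1_diff_le] for degree [L + L] and upper bound
    [2 + 2 * eps * 2 ^ k]. *)
Lemma uniquely_decides_query_bound {n k w a L : nat} (V : verifier R n w a) (eps : R) :
  (k <= n)%N -> 0 <= eps -> valid_verifier L V ->
  uniquely_decides L V (@reflect_yes R k n) (@reflect_no R n) eps ->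
  (2 ^ k)%:R * (1 - eps - eps * (2 ^ k)%:R) <=
    4 * (L + L)%:R ^+ 2 * (2 + 2 * eps * (2 ^ k)%:R).
Proof.
move=> le_kn eps0 VV [Yes No].
have le_m : (2 ^ k <= 2 ^ n)%N by rewrite leq_exp2l.
pose T X := accept_mx L V (subset_oracle le_m X).
have {}Yes (X : {set 'I_(2 ^ k)}) : X != set0 ->
    exists omega : 'cV[C]_(2 ^ w), [/\ sqnorm omega = 1, 1 - eps <= sqnorm (T X *m omega) &
      forall v, inner omega v = 0 -> sqnorm (T X *m v) <= eps * sqnorm v].
  move=> X0; have [|omega [w1 [w_acc w_uniq]]] := Yes (subset_oracle le_m X).
    exists (subset_proj le_m X).
    by split; [exact: subset_proj_orth|split; [exact: subset_proj_rank|]].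
  exists omega; split => //; first by rewrite -accept_probE.
  by apply: sqnorm_homogeneous_le => v v1 wv; rewrite -accept_probE w_uniq.
have {}No v : sqnorm (T set0 *m v) <= eps * sqnorm v.
  (* Taking the zero vector for [w] makes the orthogonality condition void. *)
  apply: (@sqnorm_homogeneous_le _ _ _ 0) => [u u1 _|].
    rewrite -accept_probE; apply: No => //.
    by rewrite /reflect_no /subset_oracle /subset_proj big_set0 scaler0 subr0.
  by rewrite innerE /adjmx map_mx0 trmx0 mul0mx mxE.
have /fin_all_exists[omega omegaP] (i : 'I_(2 ^ k)) : exists omega : 'cV[C]_(2 ^ w),
    sqnorm omega = 1 /\ 1 - eps <= sqnorm (T [set i] *m omega).
  have [|omega [? ? _]] := Yes [set i]; last by exists omega.
  by apply/set0Pn; exists i; rewrite inE.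
have [Q [Qp Qm Qw]] := exists_projector_fixing omega.
set D := (2 ^ k)%:R in Qm *.
have epsQ : eps * frob Q <= eps * D by rewrite ler_wpM2l.
pose f X := frob (T X *m Q).
have f0 : f set0 <= eps * D.
  apply: le_trans epsQ; rewrite /f /frob mulr_sumr; apply: ler_sum => j _.
  by rewrite col_mulmx No.
have f1 i : 1 - eps <= f [set i].
  have [w1 wacc] := omegaP i; apply: (le_trans wacc).
  (* [Q] fixes the witness of [i], so it can be inserted before [T [set i]] acts. *)
  by rewrite -[X in _ *m X]Qw mulmxA sqnorm_mul_unit_le_frob.
have f_bnd X : 0 <= f X <= 2 + 2 * eps * D.
  rewrite frob_ge0 /=; have [->|X0] := eqVneq X set0.
    by apply: (le_trans f0); have := mulr_ge0 eps0 (ler0n R (2 ^ k)); rewrite -/D; lra.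
  have [om [om1 _ om_uniq]] := Yes X X0.
  apply: le_trans (_ : 2 + 2 * eps * frob Q <= _); last by rewrite -!mulrA lerD2l ler_wpM2l.
  apply: (frob_unique_le (T X) Q om eps _ om1 eps0 om_uniq Qp) => v.
  exact: accept_mx_contraction VV (reflection_adjmul _ (subset_proj_orth _ _)).
apply: le_trans (sum_set1_diff_le (L + L) f _ _ f_bnd); last first.
  apply: mdeg_le_frob => i j; rewrite -[X in mdeg_le X]addn0.
  apply: (@mdeg_le_mulmx _ _ _ _ L 0 _ (fun=> Q)) => x y; last exact: mdeg_le_cst.
  exact: mdeg_le_accept_mx.
have -> : D * (1 - eps - eps * D) = \sum_(i < 2 ^ k) (1 - eps - eps * D).
  by rewrite sumr_const card_ord -mulr_natl.
by apply: ler_sum => i _; exact: lerB (f1 i) f0.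
Qed.

End SubsetOracle.

(** * Passage to the asymptotic statement *)

(** The theorem bounds its error only from above; this replaces the error by that bound, which is
    nonnegative. *)
Lemma uniquely_decidesW {R : realType} {n w a L : nat} (V : verifier R n w a)
    (Yes No : 'M[R[i]]_(2 ^ n) -> Prop) (eps eps' : R) :
  eps <= eps' -> uniquely_decides L V Yes No eps -> uniquely_decides L V Yes No eps'.
Proof.
move=> le_eps [HY HN]; split=> [O /HY[om [om1 [acc uniq]]]|O /HN acc om om1].
  exists om; split=> //; split=> [|om' om'1 orth]; first by apply: le_trans acc; lra.
  by apply: (le_trans (uniq _ om'1 orth)).
by apply: (le_trans (acc _ om1)).
Qed.

(** Since [9 / 4 = (1 + 1 / 2) ^+ 2] is at most [expR 1], Bernoulli's inequality for [(9 / 8) ^+ n]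
    gives the factor [n]. It follows that [expR (- n%:R) * 2 ^+ n] is at most [8 / n] for positive
    [n]. *)
Lemma natr_exp2_le_expR {R : realType} (n : nat) : n%:R * 2 ^+ n <= 8 * expR (n%:R : R).
Proof.
have e_ge : 9 / 4 <= expR (1 : R).
  have -> : expR (1 : R) = expR 2^-1 * expR 2^-1 by rewrite -expRD; congr expR; lra.
  have -> : 9 / 4 = (1 + 2^-1) * (1 + 2^-1) :> R by field.
  by apply: ler_pM; rewrite ?expR_ge1Dx //; lra.
have pow_le : (8 + n%:R) * 2 ^+ n <= 8 * (9 / 4) ^+ n :> R.
  elim: n => [|n IHn]; first by rewrite !expr0; lra.
  rewrite !exprS -natr1; have := ler0n R n; have : (0 : R) <= 2 ^+ n by apply: exprn_ge0.
  nra.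
have : (9 / 4) ^+ n <= expR (n%:R : R).
  rewrite -[n%:R]mulr1 expRM_natl; apply: lerXn2r => //; rewrite nnegrE; lra.
have : (0 : R) <= 2 ^+ n by apply: exprn_ge0.
lra.
Qed.

Theorem mainTheorem1 (R : realType) :
  forall C0 : R, 0 < C0 ->
  exists c : R, 0 < c /\
  exists n0 : nat,
  forall (n k L w a : nat) (eps : R) (V : verifier R n w a),
    (n0 <= n)%N -> (k < n)%N ->
    eps <= C0 * expR (- n%:R) ->
    valid_verifier L V ->
    uniquely_decides L V (@reflect_yes R k n) (@reflect_no R n) eps ->
    c * Num.sqrt (2 ^+ k) <= L%:R.
Proof.
move=> C0 C0_gt0; exists 7^-1; split; first by rewrite invr_gt0.
(* From this threshold on, [e * 2 ^+ n <= 8 * C0 / n <= 1 / 8]. *)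
exists (Num.bound (64 * C0)) => n k L w a eps V le_n0 lt_kn le_eps VV VD.
set e := C0 * expR (- n%:R) in le_eps.
have e0 : 0 <= e by rewrite mulr_ge0 ?expR_ge0 ?ltW.
have n_ge : 64 * C0 <= n%:R.
  apply: (@le_trans _ _ (Num.bound (64 * C0))%:R); last by rewrite ler_nat.
  by apply/ltW/archi_boundP; rewrite mulr_ge0 ?ltW.
have e2n : e * 2 ^+ n <= 8^-1.
  rewrite /e expRN; have E0 := expR_gt0 (n%:R : R).
  have := natr_exp2_le_expR (R := R) n.
  rewrite mulrAC ler_pdivrMr //; have : (0 : R) <= 2 ^+ n by apply: exprn_ge0.
  nra.
have D1 : 1 <= 2 ^+ k :> R by rewrite exprn_ege1 // ler1n.
have eD : e * 2 ^+ k <= 8^-1.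
  apply: le_trans e2n; rewrite ler_wpM2l //; apply: ler_weXn2l; [lra|exact: ltnW].
have := uniquely_decides_query_bound V e (ltnW lt_kn) e0 VV (uniquely_decidesW V _ _ _ _ le_eps VD).
rewrite natrX natrD => bound.
(* As [e <= e * 2 ^+ k <= 1 / 8], the left factor is at least [3 / 4] and the right side at most
   [36 * L ^+ 2]. Hence [2 ^+ k <= 48 * L ^+ 2], and 48 is rounded up to the square of 7. *)
have DL : 2 ^+ k <= (7 * L%:R) ^+ 2 :> R by have := sqr_ge0 (L%:R : R); nra.
rewrite ler_pdivrMl //; apply: le_trans (_ : Num.sqrt ((7 * L%:R) ^+ 2) <= _).
  by rewrite ler_sqrt // sqr_ge0.
by rewrite sqrtr_sqr ger0_norm // mulr_ge0.
Qed.
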